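(* Let $W_0=\mathbb{N}$ and let $(d_n)_{n\ge1}$ and $(s_n)_{n\ge1}$ be the deletion and survivor sequences produced by the golden sieve. (i) The deletion sequence $(d_n)$ is the $(0,1,2,3)$-hiccup sequence, with $d_1=1$. Explicitly, for every $n\ge2$, $$d_n-d_{n-1}=\begin{cases}2 & \text{if } n\in\{d_1,d_2,\ldots\},\\ 3 & \text{if } n\notin\{d_1,d_2,\ldots\}.\end{cases}$$ (ii) The survivor sequence $(s_n)$ is, for $n\ge3$, a $(0,s_1,2,1)$-hiccup sequence. Explicitly, for every $n\ge3$, $$s_n-s_{n-1}=\begin{cases}2 & \text{if } n\in\{s_1,s_2,\ldots\},\\ 1 & \text{if } n\notin\{s_1,s_2,\ldots\}.\end{cases}$$ (The initial gap $s_2-s_1=1$ does not follow this rule, although $2\in\{s_k\}$.) The gap between consecutive deletions is $2$ or $3$ and the gap between consecutive survivors is $1$ or $2$.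
   Context: $\mathbb{N}=\{1,2,3,\ldots\}$. For a strictly increasing sequence $X$ of positive integers, $X(k)$ denotes its $k$-th term. Golden sieve: let $W_0=(w_1<w_2<\cdots)$ be an infinite strictly increasing sequence of positive integers. For $n\ge1$ define inductively $h_n:=W_{n-1}(n)$ (the pointer), $d_n:=W_{n-1}(h_n)$ (the deletion), and let $W_n$ be the increasing sequence obtained from $W_{n-1}$ by removing the value $d_n$. The survivor sequence $(s_n)_{n\ge1}$ is the increasing enumeration of $W_0\setminus\{d_1,d_2,\ldots\}$. Hiccup sequences: let $y,z$ be distinct positive integers, $x\ge0$ and $j\ge0$ integers. An increasing sequence $(x_n)_{n\ge1}$ of integers with $x_1=x$ is a $(j,x,y,z)$-hiccup sequence if for every $n\ge2$, $x_n-x_{n-1}=y$ if $n-j\in\{x_1,\ldots,x_{n-1}\}$ and $x_n-x_{n-1}=z$ otherwise. *)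

(* Defs.v *)
From mathcomp Require Import all_boot.
From mathcomp Require Import boolp classical_sets.

Set Implicit Arguments.
Unset Strict Implicit.
Unset Printing Implicit Defensive.

Local Open Scope classical_set_scope.

(* Sequences (u_n)_{n >= 1} are functions [u : nat -> nat] read at indices
   n >= 1 only: the value [u 0] is irrelevant and never constrained. *)

Definition terms (u : nat -> nat) : set nat := [set u k | k in [set k | 1 <= k]].

Definition increasing (u : nat -> nat) : Prop :=
  forall m n, 1 <= m -> m < n -> u m < u n.

(* Up to the junk value at 0, there is exactly one such sequence when A is
   infinite.  When A is finite there is none, and the result is constantly 0. *)
Definition increasing_enumeration (A : set nat) : nat -> nat :=
  xget (fun=> 0) [set u | increasing u /\ terms u = A].

(* [sieve W0 n] is W_n.  The value W (W n.+1) removed at step n.+1, with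
   W = W_n, is [deletion W0 n.+1] by definition. *)
Fixpoint sieve (W0 : nat -> nat) (n : nat) : nat -> nat :=
  if n is m.+1 then
    let W := sieve W0 m in increasing_enumeration (terms W `\ W (W m.+1))
  else W0.

Definition pointer (W0 : nat -> nat) (n : nat) : nat := sieve W0 n.-1 n.

Definition deletion (W0 : nat -> nat) (n : nat) : nat :=
  sieve W0 n.-1 (pointer W0 n).

Definition survivor (W0 : nat -> nat) : nat -> nat :=
  increasing_enumeration (terms W0 `\` terms (deletion W0)).

(* The (j,x,y,z)-hiccup rule, imposed at the indices n >= N.  As x >= 0 and u
   increases, all terms are natural numbers; "n - j is in {u_1,...,u_{n-1}}"
   is written n = u_i + j to avoid truncated subtraction. *)
Definition hiccup_from (N j x y z : nat) (u : nat -> nat) : Prop :=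
  [/\ [/\ 0 < y, 0 < z & y <> z], increasing u, u 1 = x &
      forall n, N <= n ->
        let hit := exists i, [/\ 1 <= i, i < n & n = u i + j] in
        (hit -> u n = u n.-1 + y) /\ (~ hit -> u n = u n.-1 + z)].

Definition hiccup := hiccup_from 2.

(* Main.v *)
(** Removing the p-th term of W only shifts W by one index from p on.  Writing
    W_n for the n-th sieve of the positive integers and h_n = W_{n-1}(n), it
    follows that W_n(k) = k + n for k >= h_n, so d_n = h_n + n - 1, while
    W_n(k) does not change any more once k < h_{n+1}.  Hence s_k = k + m
    whenever h_m <= k < h_{m+1}: the survivor gap at n is 2 exactly when n is a
    pointer.  As s_n = h_n for n >= 2, the pointers above 1 are the survivors
    above 2, and the survivor gaps give the deletion gaps through
    d_n = s_n + n - 1. *)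
Require Import Defs.
From mathcomp Require Import all_boot.
From mathcomp Require Import boolp classical_sets.
From mathcomp Require Import zify.

Set Implicit Arguments.
Unset Strict Implicit.
Unset Printing Implicit Defensive.

Local Open Scope classical_set_scope.

(** * Increasing sequences and uniqueness of enumerations *)

Lemma increasing_ltE (u : nat -> nat) (m n : nat) : increasing u ->
  1 <= m -> 1 <= n -> (u m < u n) = (m < n).
Proof.
move=> iu m1 n1; case: (ltngtP m n) => [mn|nm|->]; last by rewrite ltnn.
- exact: iu.
- by have := iu _ _ n1 nm; lia.
Qed.

Lemma increasing_inj (u : nat -> nat) (m n : nat) : increasing u ->
  1 <= m -> 1 <= n -> u m = u n -> m = n.
Proof.
move=> iu m1 n1 e.
by have := increasing_ltE iu m1 n1; have := increasing_ltE iu n1 m1; lia.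
Qed.

Lemma increasing_ge (u : nat -> nat) (k : nat) : increasing u ->
  1 <= u 1 -> 1 <= k -> k <= u k.
Proof.
move=> iu u1; elim: k => // -[//|k] IH _.
by have := iu k.+1 k.+2 isT (ltnSn _); have := IH isT; lia.
Qed.

(** At the first index of disagreement, the smaller value would be a term of the other sequence at
    an earlier index, where the two agree; this contradicts strict increase. *)
Lemma enumeration_unique (u v : nat -> nat) : increasing u -> increasing v ->
  terms u = terms v -> forall k, 1 <= k -> u k = v k.
Proof.
move=> iu iv uv k; elim/ltn_ind: k => k IH k1.
have no_lt (a b : nat -> nat) : increasing a -> increasing b ->
    terms a = terms b -> (forall j, j < k -> 1 <= j -> a j = b j) ->
    ~ a k < b k.
  move=> ia ib ab agree lt_ab.
  have : terms a (a k) by exists k.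
  rewrite ab => -[j /= j1 bj].
  have jk : j < k by rewrite -(increasing_ltE ib j1 k1) bj.
  by have := ia _ _ j1 jk; rewrite agree // bj ltnn.
have := no_lt u v iu iv uv IH.
have := no_lt v u iv iu (esym uv) (fun j jk j1 => esym (IH j jk j1)).
by lia.
Qed.

(** The witness [u] rules out the default value of [xget], and uniqueness identifies the chosen
    sequence with [u]. *)
Lemma increasing_enumerationE (A : set nat) (u : nat -> nat) : increasing u ->
  terms u = A -> forall k, 1 <= k -> increasing_enumeration A k = u k.
Proof.
move=> iu uA k k1.
have [ie eA] : increasing (increasing_enumeration A) /\
    terms (increasing_enumeration A) = A.
  exact: (@xgetPex _ (fun=> 0) [set v | increasing v /\ terms v = A]
            (ex_intro _ u (conj iu uA))).
by apply: enumeration_unique => //; rewrite eA.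
Qed.

(** * Removing one term, in explicit form *)

Definition skip (p : nat) (u : nat -> nat) (k : nat) : nat :=
  if k < p then u k else u k.+1.

Lemma skip_increasing (p : nat) (u : nat -> nat) :
  increasing u -> increasing (skip p u).
Proof.
move=> iu m n m1 mn; rewrite /skip.
by case: (ltnP m p) => mp; case: (ltnP n p) => np; apply: iu; lia.
Qed.

Lemma terms_skip (p : nat) (u : nat -> nat) : increasing u -> 1 <= p ->
  terms (skip p u) = terms u `\ u p.
Proof.
move=> iu p1; apply/seteqP; split=> [_ [k /= k1 <-]|_ [[k /= k1 <-] /= ne]].
- rewrite /skip; case: (ltnP k p) => kp; split; first by exists k.
  + by move=> /= /(increasing_inj iu k1 p1); lia.
  + by exists k.+1.
  + by move=> /= /(increasing_inj iu (ltn0Sn k) p1); lia.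
- case: (ltngtP k p) => kp; last by rewrite kp in ne.
  + by exists k => //; rewrite /skip kp.
  + exists k.-1; first by rewrite /=; lia.
    by rewrite /skip ltnNge (_ : p <= k.-1) /= ?prednK //; lia.
Qed.

(** * The sieve of the positive integers and its pointers *)

Local Notation W := (sieve (fun k => k)).
Local Notation h := (pointer (fun k => k)).
Local Notation del := (deletion (fun k => k)).
Local Notation surv := (survivor (fun k => k)).

(** Trades the enumeration obtained by choice for the computable [skip]. The bound on the first term
    keeps the removed index positive. *)
Lemma sieve_step (n : nat) : increasing (W n) -> 1 <= W n 1 ->
  [/\ increasing (W n.+1), terms (W n.+1) = terms (W n) `\ del n.+1 &
      forall k, 1 <= k -> W n.+1 k = skip (h n.+1) (W n) k].
Proof.
move=> iW W1.
have h1 : 1 <= h n.+1.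
  by have := @increasing_ge _ n.+1 iW W1 isT; rewrite /pointer /=; lia.
have E := increasing_enumerationE (skip_increasing (h n.+1) iW)
  (terms_skip iW h1).
have iS : increasing (W n.+1).
  move=> a b a1 ab; rewrite /= !E; try lia.
  exact: skip_increasing.
split=> //; rewrite -(terms_skip iW h1); apply/seteqP.
by split=> _ [k /= k1 <-]; exists k => //; rewrite /= E.
Qed.

Lemma sieve_inv (n : nat) : increasing (W n) /\ 1 <= W n 1.
Proof.
elim: n => [|n [iW W1]]; first by split=> // a b.
have [iS _ E] := sieve_step iW W1; split=> //; rewrite E // /skip.
by case: ifP => // _; have := iW 1 2 isT isT; lia.
Qed.

Lemma sieve_increasing (n : nat) : increasing (W n).
Proof. by case: (sieve_inv n). Qed.

Lemma sieve_ge (n k : nat) : 1 <= k -> k <= W n k.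
Proof. by case: (sieve_inv n) => iW W1; exact: increasing_ge. Qed.

Lemma sieveS (n k : nat) : 1 <= k -> W n.+1 k = skip (h n.+1) (W n) k.
Proof.
by case: (sieve_inv n) => iW W1; case: (sieve_step iW W1) => _ _; apply.
Qed.

Lemma terms_sieveS (n : nat) : terms (W n.+1) = terms (W n) `\ del n.+1.
Proof. by case: (sieve_inv n) => iW W1; case: (sieve_step iW W1). Qed.

Lemma sieveS_ge (n k : nat) : 1 <= k -> W n k <= W n.+1 k.
Proof.
move=> k1; rewrite sieveS // /skip; case: ifP => // _.
by apply/ltnW/sieve_increasing.
Qed.

Lemma pointer_ltS (n : nat) : 1 <= n -> h n < h n.+1.
Proof.
case: n => // n _; rewrite /pointer /=.
(* With n shifted by one, the chain is W_{n-1}(n) <= W_n(n) < W_n(n+1). *)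
have := sieveS_ge n (ltn0Sn n).
by have := @sieve_increasing n.+1 n.+1 n.+2 isT (ltnSn _) => /=; lia.
Qed.

Lemma pointer_ge (n : nat) : 1 <= n -> n <= h n.
Proof. exact: sieve_ge. Qed.

Lemma pointer_increasing : increasing h.
Proof.
move=> m n m1; elim: n => // n IH; rewrite ltnS leq_eqVlt => /orP[/eqP <-|mn].
- exact: pointer_ltS.
- by have := IH mn; have := @pointer_ltS n; lia.
Qed.

(** As pointers increase, each of the first n removals takes place at an index at most k and so
    advances the k-th term by one more place. *)
Lemma sieve_shift (n k : nat) : 1 <= n -> h n <= k -> W n k = k + n.
Proof.
case: n => // n _; elim: n k => [|n IH] k hk.
- by have h1 := @pointer_ge 1 isT; rewrite sieveS /skip ?(leq_gtF hk) /=; lia.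
- have := @pointer_ge n.+2 isT; have := @pointer_ltS n.+1 isT => h1 h2.
  by rewrite sieveS; [rewrite /skip (leq_gtF hk) IH|]; lia.
Qed.

(** All removals after step n take place at indices at least [h n.+1], hence beyond k. *)
Lemma sieve_stable (n m k : nat) : 1 <= k -> k < h n.+1 -> n <= m ->
  W m k = W n k.
Proof.
move=> k1 kh; elim: m => [|m IH]; first by rewrite leqn0 => /eqP ->.
rewrite leq_eqVlt => /orP[/eqP -> //|]; rewrite ltnS => nm.
rewrite sieveS // /skip IH // ifT //.
move: nm; rewrite leq_eqVlt => /orP[/eqP <- //|nm].
by have := @pointer_increasing n.+1 m.+1 isT nm; lia.
Qed.

Lemma pointer1 : h 1 = 1. Proof. by []. Qed.

Lemma pointer2 : h 2 = 3.
Proof. by rewrite /pointer [2.-1]/= sieve_shift. Qed.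

Lemma deletionE (n : nat) : 1 <= n -> del n = h n + n.-1.
Proof.
case: n => [//|[|n]] _; first by [].
rewrite /deletion [n.+2.-1]/= sieve_shift //.
by have := @pointer_ltS n.+1 isT; lia.
Qed.

Lemma pointer_gt (n : nat) : 2 <= n -> n < h n.
Proof.
case: n => [//|[//|n]] _; elim: n => [|n IH]; first by rewrite pointer2.
by have := @pointer_ltS n.+2 isT; lia.
Qed.

(** * Survivors as the diagonal of the sieve *)

Lemma sieve_diag (k m : nat) : 1 <= k -> k <= m -> W m k = W k k.
Proof.
(* The next pointer exceeds k+1, so the k-th term is final from step k on. *)
by move=> k1; apply: sieve_stable => //; have := @pointer_gt k.+1; lia.
Qed.

Lemma terms_sieveE (n v : nat) : terms (W n) v <->
  1 <= v /\ forall i, 1 <= i <= n -> v <> del i.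
Proof.
elim: n => [|n IH].
  split=> [[k /= k1 <-]|[v1 _]]; last by exists v.
  by split=> // i; lia.
rewrite terms_sieveS; split=> [[/IH[v1 vd] /= vn]|[v1 vd]].
- split=> // i; case: (eqVneq i n.+1) => [-> //|ne] i1.
  by apply: vd; lia.
- split; last by move=> /=; apply: vd; lia.
  by apply/IH; split=> // i i1; apply: vd; lia.
Qed.

Lemma diag_increasing : increasing (fun k => W k k).
Proof.
move=> m n m1 mn; rewrite -(sieve_diag m1 (ltnW mn)).
exact: sieve_increasing.
Qed.

Lemma terms_diagE :
  terms (fun k => W k k) = terms (fun k => k) `\` terms del.
Proof.
apply/seteqP; split=> [_ [k /= k1 <-]|v [[w /= v1 wv] vd]].
- split; first by exists (W k k) => //=; have := sieve_ge k k1; lia.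
  move=> [i /= i1 di].
  (* At stage max(i, k) the value [del i] is already gone while the k-th term is already final. *)
  have : terms (W (maxn i k)) (W k k).
    by exists k => //; rewrite sieve_diag // leq_maxr.
  by move=> /terms_sieveE[_ /(_ i)]; rewrite di i1 leq_maxl; apply.
(* A value v that is never deleted sits in [W v] at some index k <= v, where the sieve has already
   reached its diagonal value. *)
- have : terms (W v) v.
    apply/terms_sieveE; split=> [|i /andP[i1 _] e]; first lia.
    by apply: vd; exists i.
  move=> [k /= k1 kv]; exists k => //=.
  by have := sieve_ge v k1; rewrite kv => kv'; rewrite -[RHS]kv sieve_diag.
Qed.

Lemma survivorE (k : nat) : 1 <= k -> surv k = W k k.
Proof. exact: increasing_enumerationE diag_increasing terms_diagE k. Qed.

Lemma survivor_increasing : increasing surv.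
Proof.
move=> m n m1 mn; rewrite !survivorE //; last lia.
exact: diag_increasing.
Qed.

Lemma terms_survivorE (v : nat) : 1 <= v -> terms surv v <-> ~ terms del v.
Proof.
move=> v1; have <- : terms (fun k => W k k) = terms surv.
  by apply/seteqP; split=> _ [k /= k1 <-]; exists k => //=; rewrite survivorE.
by rewrite terms_diagE; split=> [[]|vd] //; split=> //; exists v.
Qed.

(** Step n removes a term at an index beyond n, so W_n(n) = W_{n-1}(n). This fails at n = 1, where
    the pointer is 1 and the survivor is 2. *)
Lemma survivor_pointer (n : nat) : 2 <= n -> surv n = h n.
Proof.
case: n => // n n1; rewrite survivorE //.
by apply: sieve_stable => //; exact: pointer_gt.
Qed.

Lemma survivor1 : surv 1 = 2.
Proof. by rewrite survivorE // sieve_shift. Qed.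

(** * Gaps between survivors *)

Lemma survivor_shift (m k : nat) : 1 <= m -> h m <= k -> k < h m.+1 ->
  surv k = k + m.
Proof.
move=> m1 hk kh; have mh := pointer_ge m1.
by rewrite survivorE ?(@sieve_stable m) ?sieve_shift //; lia.
Qed.

(** The index before [h m] still has shift m-1, while [h m] has shift m. *)
Lemma survivor_gap_pointer (m : nat) : 2 <= m ->
  surv (h m) = surv (h m).-1 + 2.
Proof.
case: m => [//|[//|m]] _.
have h1 := @pointer_ltS m.+1 isT; have h2 := @pointer_ltS m.+2 isT.
by rewrite (@survivor_shift m.+2) // (@survivor_shift m.+1) //; lia.
Qed.

Lemma pointer_bracket (n : nat) : 1 <= n ->
  exists2 m, 1 <= m & h m <= n < h m.+1.
Proof.
elim: n => [//|[|n] IH] _; first by exists 1; rewrite // pointer2.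
have [m m1 /andP[hm mh]] := IH isT.
have := @pointer_ltS m.+1 isT; case: (ltnP n.+2 (h m.+1)) => nh h1.
- by exists m => //; lia.
- by exists m.+1 => //; lia.
Qed.

Lemma survivor_gap_other (n : nat) : 2 <= n ->
  (forall m, 1 <= m -> n <> h m) -> surv n = surv n.-1 + 1.
Proof.
move=> n2 nh; have [m m1 /andP[hm mh]] := pointer_bracket (ltnW n2).
have ne := nh m m1.
by rewrite !(@survivor_shift m) //; lia.
Qed.

Lemma survivor_gap_hit (n : nat) : 3 <= n -> terms surv n ->
  surv n = surv n.-1 + 2.
Proof.
move=> n3 [k /= k1 kn].
(* The first survivor, 2, is not a pointer; n >= 3 excludes it. *)
have k2 : 2 <= k by case: k k1 kn => [|[|k]] //; rewrite survivor1; lia.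
by rewrite -kn (survivor_pointer k2) survivor_gap_pointer.
Qed.

Lemma survivor_gap_miss (n : nat) : 3 <= n -> ~ terms surv n ->
  surv n = surv n.-1 + 1.
Proof.
move=> n3 ns; apply: survivor_gap_other => [|m m1 nm]; first lia.
(* Likewise the first pointer, 1, is not a survivor. *)
have m2 : 2 <= m by case: m m1 nm => [|[|m]] //; rewrite pointer1; lia.
by apply: ns; exists m => //=; rewrite survivor_pointer.
Qed.

(** * Gaps between deletions *)

Lemma survivor2 : surv 2 = 3.
Proof. by rewrite survivor_pointer // pointer2. Qed.

Lemma deletion2 : del 2 = 4.
Proof. by rewrite deletionE // pointer2. Qed.

(** A deletion gap is the survivor gap plus one, written without subtraction; n >= 3 makes both
    pointers survivors. *)
Lemma deletion_gap_survivor (n : nat) : 3 <= n ->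
  del n + surv n.-1 = del n.-1 + surv n + 1.
Proof. by move=> n3; rewrite !deletionE ?survivor_pointer; lia. Qed.

Lemma deletion_increasing : increasing del.
Proof.
move=> m n m1 mn; have := pointer_increasing m1 mn.
by rewrite !deletionE; lia.
Qed.

Lemma deletion_gt (n : nat) : 2 <= n -> n < del n.
Proof. by move=> n2; have := pointer_gt n2; rewrite deletionE; lia. Qed.

Lemma survivor_gt (n : nat) : 1 <= n -> n < surv n.
Proof.
case: n => [//|[|n]] _; first by rewrite survivor1.
by rewrite survivor_pointer //; exact: pointer_gt.
Qed.

Lemma not_terms_deletion2 : ~ terms del 2.
Proof.
by apply/terms_survivorE => //; exists 1 => //=; exact: survivor1.
Qed.

(** Deletions and survivors are complementary, so a deleted n has survivor gap 1. The case n = 2 is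
    vacuous, as 2 survives. *)
Lemma deletion_gap_hit (n : nat) : 2 <= n -> terms del n ->
  del n = del n.-1 + 2.
Proof.
case: n => [//|[//|[_ /not_terms_deletion2 //|n]]] _ dn.
have := @deletion_gap_survivor n.+3 isT.
by rewrite (@survivor_gap_miss n.+3) //; [lia|move=> /terms_survivorE; apply].
Qed.

Lemma deletion_gap_miss (n : nat) : 2 <= n -> ~ terms del n ->
  del n = del n.-1 + 3.
Proof.
(* The survivor rule starts at 3, so the gap from 1 to 4 at n = 2 is computed directly. *)
case: n => [//|[//|[_ _|n]]]; first by rewrite deletion2.
move=> _ dn; have := @deletion_gap_survivor n.+3 isT.
by rewrite (@survivor_gap_hit n.+3) //; [lia|apply/terms_survivorE].
Qed.

(* At offset 0 the rule may range over all terms, a term of index i >= n >= N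
   being larger than n. *)
Lemma hiccup_fromI (N y z : nat) (u : nat -> nat) :
  0 < y -> 0 < z -> y <> z -> increasing u -> 1 <= N ->
  (forall i, N <= i -> i < u i) ->
  (forall n, N <= n -> terms u n -> u n = u n.-1 + y) ->
  (forall n, N <= n -> ~ terms u n -> u n = u n.-1 + z) ->
  hiccup_from N 0 (u 1) y z u.
Proof.
move=> y0 z0 yz iu N1 ugt hit miss; split=> // n Nn.
have E : (exists i, [/\ 1 <= i, i < n & n = u i + 0]) <-> terms u n.
  split=> [[i [i1 _ ->]]|[i /= i1 un]]; first by exists i; rewrite ?addn0.
  exists i; split; rewrite ?addn0 //.
  case: (ltnP i N) => [|/ugt]; lia.
by rewrite /= E; split; [exact: hit|exact: miss].
Qed.

Theorem theorem2p8 (d s : nat -> nat)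
  (hd : d = deletion (fun k => k)) (hs : s = survivor (fun k => k)) :
  (* (i) *)
  [/\ hiccup 0 1 2 3 d,
      d 1 = 1 &
      forall n, 2 <= n ->
        (terms d n -> d n = d n.-1 + 2) /\ (~ terms d n -> d n = d n.-1 + 3)] /\
  (* (ii) *)
  [/\ hiccup_from 3 0 (s 1) 2 1 s,
      forall n, 3 <= n ->
        (terms s n -> s n = s n.-1 + 2) /\ (~ terms s n -> s n = s n.-1 + 1),
      s 2 = s 1 + 1 &
      terms s 2] /\
  (* gaps *)
  (forall n, 2 <= n -> d n = d n.-1 + 2 \/ d n = d n.-1 + 3) /\
  (forall n, 2 <= n -> s n = s n.-1 + 1 \/ s n = s n.-1 + 2).
Proof.
rewrite {d}hd {s}hs.
split; [split|split; [split|split]].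
- apply: (@hiccup_fromI 2 2 3 del) => //.
  + exact: deletion_increasing.
  + exact: deletion_gt.
  + exact: deletion_gap_hit.
  + exact: deletion_gap_miss.
- by [].
- by move=> n n2; split; [exact: deletion_gap_hit|exact: deletion_gap_miss].
- apply: hiccup_fromI => //.
  + exact: survivor_increasing.
  + by move=> i i3; apply: survivor_gt; lia.
  + exact: survivor_gap_hit.
  + exact: survivor_gap_miss.
- by move=> n n3; split; [exact: survivor_gap_hit|exact: survivor_gap_miss].
- by rewrite survivor1 survivor2.
- by exists 1 => //=; exact: survivor1.
- move=> n n2; case: (pselect (terms del n)) => dn.
  + by left; exact: deletion_gap_hit.
  + by right; exact: deletion_gap_miss.
(* The gap at 2 breaks the rule and is read off from the values 2 and 3. *)
- case=> [//|[//|[_|n _]]]; first by left; rewrite survivor1 survivor2.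
  case: (pselect (terms surv n.+3)) => sn.
  + by right; exact: survivor_gap_hit.
  + by left; exact: survivor_gap_miss.
Qed.
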